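(* Let $(\Omega,\mathcal{F},P)$ be a probability space and $T:\Omega\to\Omega$ a measurable transformation. Suppose there exists an upper probability $V$ on $(\Omega,\mathcal{F})$ which is $T$-invariant and ergodic with respect to $T$, with $P\in\operatorname{core}(V)$. Then there exists a unique ergodic probability $Q\in\mathcal{M}^e(T)\cap\operatorname{core}(V)$ such that for every $f\in L^1(\Omega,\mathcal{F},Q)$, $$\lim_{n\to\infty}\frac{1}{n}\sum_{i=0}^{n-1}f(T^i\omega)=\int f\,dQ\quad\text{for }P\text{-a.s. }\omega\in\Omega.$$
   Context: A capacity is a monotone map $\mu:\mathcal{F}\to[0,1]$ with $\mu(\emptyset)=0,\mu(\Omega)=1$. An upper probability is a capacity $V$ with $V(A)=\max_{P'\in\Lambda}P'(A)$ for a weak* (setwise convergence) compact set $\Lambda$ of probabilities. $V$ is $T$-invariant if $V(T^{-1}A)=V(A)$ for all $A$. $\mathcal{I}=\{A\in\mathcal{F}:T^{-1}A=A\}$. A $T$-invariant capacity $\mu$ is ergodic if for each $B\in\mathcal{I}$, $\mu(B)\in\{0,1\}$ and ($\mu(B)=0$ or $\mu(\Omega\setminus B)=0$). $\operatorname{core}(V)$ is the set of finitely additive normalized set functions dominated by $V$. $\mathcal{M}^e(T)$ denotes the $T$-invariant probabilities $Q$ with $Q(\mathcal{I})\subset\{0,1\}$. $P$ itself need not be $T$-invariant. *)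

(* Defs.v *)
From HB Require Import structures.
From mathcomp Require Import all_boot all_order all_algebra.
From mathcomp Require Import all_classical all_reals all_analysis.
Set Implicit Arguments. Unset Strict Implicit. Unset Printing Implicit Defensive.
Import Order.TTheory GRing.Theory Num.Theory.
Import numFieldNormedType.Exports.
Local Open Scope classical_set_scope.
Local Open Scope ring_scope.

Section Defs.
Context {d : measure_display} {Omega : measurableType d} {R : realType}.

Definition prob_vec (Q : probability Omega R) : set Omega -> R :=
  fun A => if `[< measurable A >] then fine (Q A) else 0.

(* compactness in the topology of setwise convergence on the measurable sets:
   the initial topology of Q |-> (Q(A))_{A in F}, i.e. compactness of the
   image in the pointwise (product) topology *)
Definition setwise_compact (Lam : set (probability Omega R)) : Prop :=
  compact (prob_vec @` Lam : set {ptws set Omega -> R}).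

Definition upper_probability (V : set Omega -> R) : Prop :=
  exists Lam : set (probability Omega R),
    Lam !=set0 /\ setwise_compact Lam /\
    forall A, measurable A ->
      (exists2 P', Lam P' & fine (P' A) = V A) /\
      (forall P', Lam P' -> fine (P' A) <= V A).

Definition T_invariant_cap (T : Omega -> Omega) (V : set Omega -> R) : Prop :=
  forall A, measurable A -> V (T @^-1` A) = V A.

Definition invariant_set (T : Omega -> Omega) (B : set Omega) : Prop :=
  measurable B /\ T @^-1` B = B.

Definition ergodic_cap (T : Omega -> Omega) (V : set Omega -> R) : Prop :=
  T_invariant_cap T V /\
  forall B, invariant_set T B ->
    (V B = 0 \/ V B = 1) /\ (V B = 0 \/ V (~` B) = 0).

Definition in_core (V : set Omega -> R) (Q : probability Omega R) : Prop :=
  forall A, measurable A -> fine (Q A) <= V A.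

Definition ergodic_prob (T : Omega -> Omega) (Q : probability Omega R) : Prop :=
  (forall A, measurable A -> Q (T @^-1` A) = Q A) /\
  forall B, invariant_set T B -> Q B = 0%E \/ Q B = 1%E.

Definition birkhoff_avg (T : Omega -> Omega) (f : Omega -> R) (w : Omega)
  (n : nat) : R := n%:R^-1 * \sum_(i < n) f (iter i T w).

End Defs.

(* Main.v *)
(* By compactness V is continuous at the empty set, so a limit along an
   ultrafilter of the averages of P, P \o T^-1, P \o T^-2, ... is a countably
   additive T-invariant probability Q dominated by V.  If g is Q-integrable with
   negative integral, the set where the Birkhoff sums of g are bounded above is
   exactly invariant and, by the maximal ergodic theorem, not Q-null; ergodicity
   of V then makes its complement V-null, hence P-null.  Taking for g the
   functions +-(f - m) - 1/k, where m is the Q-integral of f, gives the P-a.s.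
   convergence of the averages of f to m.  Uniqueness follows from the case of
   indicator functions. *)
From HB Require Import structures.
Require Import Defs.
From mathcomp Require Import all_boot all_order all_algebra.
From mathcomp Require Import all_classical all_reals all_analysis.
From mathcomp Require Import ring lra.
Set Implicit Arguments.
Unset Strict Implicit.
Unset Printing Implicit Defensive.
Import Order.TTheory GRing.Theory Num.Theory.
Import numFieldNormedType.Exports.
Local Open Scope classical_set_scope.
Local Open Scope ring_scope.

(** * Monotonicity and continuity at the empty set of upper probabilities *)

Section UpperProbability.
Context {d : measure_display} {Omega : measurableType d} {R : realType}.
Implicit Types (V : set Omega -> R) (A B : set Omega).

Lemma upper_probability_ge0 V A :
  upper_probability V -> measurable A -> 0 <= V A.
Proof.
by move=> [L [_ [_ VL]]] mA; have [[P' _ <-] _] := VL _ mA; rewrite fine_ge0.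
Qed.

Lemma fine_probability_le (P' : probability Omega R) A B :
  measurable A -> measurable B -> A `<=` B -> fine (P' A) <= fine (P' B).
Proof.
move=> mA mB AB; apply: fine_le; [exact: fin_num_measure..|].
by apply: le_measure => //; rewrite inE.
Qed.

Lemma upper_probability_le V A B : upper_probability V ->
  measurable A -> measurable B -> A `<=` B -> V A <= V B.
Proof.
move=> [L [_ [_ VL]]] mA mB AB; have [[P' LP' <-] _] := VL _ mA.
have [_ /(_ _ LP')] := VL _ mB; apply: le_trans.
exact: fine_probability_le.
Qed.

(* Dini: if V (F n) >= e for all n, a cluster point of maximizers of F n would
   be a probability giving mass at least e to every F n. *)
Lemma upper_probability_cvg0 V (F : (set Omega)^nat) : upper_probability V ->
  (forall n, measurable (F n)) -> nonincreasing_seq F ->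
  \bigcap_n F n = set0 -> V \o F @ \oo --> 0.
Proof.
move=> uV mF Fni F0; have [L [_ [cL VL]]] := uV.
have Vni m n : (m <= n)%N -> V (F n) <= V (F m).
  move=> mn; apply: upper_probability_le => //.
  by have /subsetPset := Fni _ _ mn.
apply/cvgrPdist_lt => e e0.
(* Since [V (F n)] is nonincreasing and nonnegative, a single value below [e] would give
   convergence; hence all values are at least [e]. *)
apply: contrapT => nV.
have eV n : e <= V (F n).
  rewrite leNgt; apply/negP => Vn; apply: nV.
  exists n => // m /= nm; rewrite sub0r normrN ger0_norm.
    exact: le_lt_trans (Vni _ _ nm) Vn.
  exact: upper_probability_ge0.
have /choice[Pn PnE] n : exists P', L P' /\ fine (P' (F n)) = V (F n).
  by have [[P' LP' <-] _] := VL _ (mF n); exists P'.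
have pvE (P' : probability Omega R) n : prob_vec P' (F n) = fine (P' (F n)).
  by rewrite /prob_vec asboolT.
pose v n : {ptws set Omega -> R} := prob_vec (Pn n).
have [|p [[P' LP' <-] clp]] := cL (v @ \oo) _.
  by exists 0%N => // n _; exists (Pn n) => //; have [] := PnE n.
have eP' m : e <= fine (P' (F m)).
  rewrite leNgt -pvE; apply/negP => Pm.
  (* Evaluation at [F m] is continuous for the pointwise topology, so this neighbourhood meets every
     tail of [v]; but for n >= m, Pn n (F m) >= Pn n (F n) = V (F n) >= e. *)
  have nb : nbhs (prob_vec P' : {ptws set Omega -> R})
      [set w : set Omega -> R | w (F m) < e].
    have /= := @proj_continuous _ (fun=> R) (F m) (prob_vec P').
    move=> /(_ [set x | x < e]) /= h; apply: h.
    exact: lt_nbhsl.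
  have [|w [[n /= mn <-]]] := clp [set v n | n in [set n | (m <= n)%N]] _ _ nb.
    by exists m => // n mn; exists n.
  rewrite /v /= pvE ltNge => /negP; apply.
  apply: le_trans (eV n) _; rewrite -(PnE n).2.
  apply: fine_probability_le => //.
  by have /subsetPset := Fni _ _ mn.
have : (P' \o F) @ \oo --> P' (\bigcap_n F n).
  apply: nonincreasing_cvg_mu => //.
    by rewrite ltey_eq fin_num_measure.
  exact: bigcapT_measurable.
rewrite F0 measure0 => /fine_cvg/cvgrPdist_lt/(_ _ e0)[n _ /(_ n (leqnn n))].
by rewrite /= sub0r normrN ger0_norm ?fine_ge0// ltNge eP'.
Qed.

End UpperProbability.

(** * From finite additivity to countable additivity *)

Section ProbabilityFromContinuity.
Context {d : measure_display} {Omega : measurableType d} {R : realType}.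

(** For disjoint sets, finite additivity writes the mass of the union as a partial sum plus the mass
    of a tail union. The tail unions decrease to the empty set, so continuity there removes the
    remainder. *)
Lemma finitely_additive_continuous_probability (mu : set Omega -> R) :
  (forall A, measurable A -> 0 <= mu A) -> mu setT = 1 ->
  (forall A B, measurable A -> measurable B -> A `&` B = set0 ->
    mu (A `|` B) = mu A + mu B) ->
  (forall F : (set Omega)^nat, (forall n, measurable (F n)) ->
    nonincreasing_seq F -> \bigcap_n F n = set0 -> mu \o F @ \oo --> 0) ->
  exists Q : probability Omega R, forall A, measurable A -> Q A = (mu A)%:E.
Proof.
move=> mu_ge0 muT muU mu_cont.
(* A measure must be nonnegative on every set, while [mu] is controlled on measurable sets only;
   hence the value 0 elsewhere. *)
pose q (A : set Omega) : \bar R :=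
  if `[< measurable A >] then (mu A)%:E else 0%E.
have qE A : measurable A -> q A = (mu A)%:E by move=> mA; rewrite /q asboolT.
have mu0 : mu set0 = 0.
  by have := muU _ _ measurable0 measurable0 (setI0 _); rewrite setU0; lra.
have q0 : q set0 = 0%E by rewrite qE ?mu0.
have q_ge0 A : (0 <= q A)%E.
  by rewrite /q; case: asboolP => // mA; rewrite lee_fin mu_ge0.
have qS : semi_sigma_additive q.
  move=> F mF tF mUF.
  pose tl n := \bigcup_(k in [set k | (n <= k)%N]) F k.
  have mtl n : measurable (tl n) by apply: bigcup_measurable.
  have tl_split n : tl n = F n `|` tl n.+1.
    apply/seteqP; split => x.
      move=> [k /= nk Fk]; move: nk; rewrite leq_eqVlt => /predU1P[->|nk].
        by left.
      by right; exists k.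
    by move=> [Fn|[k /= nk Fk]]; [exists n => /=|exists k => //=; exact: ltnW].
  have sumE n : mu (\bigcup_k F k) = \sum_(0 <= i < n) mu (F i) + mu (tl n).
    elim: n => [|n IH].
      by rewrite big_nil add0r; congr mu; apply: eq_bigcupl; split.
    rewrite big_nat_recr//= -addrA -muU -?tl_split//.
    rewrite -subset0 => x [Fn [k /= nk Fk]].
    have nkE := tF n k I I (ex_intro _ x (conj Fn Fk)).
    by rewrite nkE ltnn in nk.
  have tl0 : mu \o tl @ \oo --> 0.
    apply: mu_cont => //.
      move=> m n mn; apply/subsetPset => x [k /= nk Fk]; exists k => //=.
      exact: leq_trans nk.
    rewrite -subset0 => x tlx.
    have [k _ Fk] := tlx 0%N I.
    have [j /= kj Fj] := tlx k.+1 I.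
    by have jk := tF j k I I (ex_intro _ x (conj Fj Fk)); rewrite jk ltnn in kj.
  have -> : (fun n => \sum_(0 <= i < n) q (F i))%E =
      EFin \o (fun n => mu (\bigcup_k F k) - mu (tl n)).
    apply/funext => n /=; rewrite (sumE n) addrK -sumEFin.
    by apply: eq_bigr => i _; rewrite qE.
  rewrite qE//; apply: cvg_EFin; first by near=> n.
  by rewrite -[X in _ --> X]subr0; apply: cvgB => //; exact: cvg_cst.
pose m := isMeasure.Build d Omega R q q0 q_ge0 qS.
pose Qm : measure Omega R := HB.pack q m.
have QmT : Qm setT = 1%E by rewrite /Qm/= qE// muT.
pose pm := Measure_isProbability.Build d Omega R Qm QmT.
pose Q : probability Omega R := HB.pack q m pm.
by exists Q => A mA; rewrite /Q/= qE.
Unshelve. all: by end_near. Qed.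

End ProbabilityFromContinuity.

(** * Limits of bounded sequences along an ultrafilter *)

Section UltrafilterLimit.
Context {R : realType}.

(** Compactness of [a, b] gives a cluster point, and an ultrafilter converges to each of its cluster
    points because it contains every set or its complement. *)
Lemma ultrafilter_cvg_bounded (U : set_system nat) (u : nat -> R) (a b : R) :
  UltraFilter U -> (forall n, a <= u n <= b) -> exists l : R, u @ U --> l.
Proof.
move=> UU uab.
have [|l [_ cl]] := @segment_compact R a b (u @ U) _.
  change (U (u @^-1` `[a, b])).
  by apply: filterE => n /=; rewrite in_itv/=.
exists l => B /= nB.
have [//|UB] := in_ultra_setVsetC (u @^-1` B) UU.
have [|x [nBx Bx]] := cl (~` B) B _ nB; first exact: UB.
by [].
Qed.

End UltrafilterLimit.

(** * Maximal ergodic theorem for an invariant probability *)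

Section MaximalErgodic.
Context {d : measure_display} {Omega : measurableType d} {R : realType}.
Variables (Q : probability Omega R) (T : Omega -> Omega).
Hypothesis mT : measurable_fun setT T.
Hypothesis QT : forall A, measurable A -> Q (T @^-1` A) = Q A.

Lemma integrable_comp_invariant (f : Omega -> \bar R) :
  Q.-integrable setT f -> Q.-integrable setT (f \o T).
Proof.
move=> fi; have /integrableP[mf foo] := fi; apply/integrableP; split.
  exact: (measurable_comp measurableT _ mf mT).
have <- : (\int[pushforward Q T]_y `|f y| = \int[Q]_x `|(f \o T) x|)%E.
  rewrite ge0_integral_pushforward//.
  exact: measurable_int (integrable_abse fi).
rewrite (eq_measure_integral Q)// => A mA _.
exact: QT.
Qed.

Lemma integral_comp_invariant (f : Omega -> \bar R) :
  Q.-integrable setT f ->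
  (\int[Q]_x (f (T x)) = \int[Q]_x f x)%E.
Proof.
move=> fi.
have /= <- := @integral_pushforward _ _ _ _ R _ mT Q setT f _ _ _.
- by rewrite (eq_measure_integral Q)// => A mA _; exact: QT.
- exact: (measurable_int _ fi).
- by rewrite preimage_setT; exact: integrable_comp_invariant.
- by [].
Qed.

Definition birkhoff_sum (g : Omega -> R) n x := \sum_(i < n) g (iter i T x).

Lemma birkhoff_sumS g n x :
  birkhoff_sum g n.+1 x = g x + birkhoff_sum g n (T x).
Proof.
rewrite /birkhoff_sum big_ord_recl/=; congr +%R.
by apply: eq_bigr => i _; rewrite -iterS iterSr.
Qed.

(* [max_birkhoff g n] is the maximum of [birkhoff_sum g k] for k <= n. *)
Fixpoint max_birkhoff (g : Omega -> R) n : Omega -> R :=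
  if n is m.+1 then fun x => Num.max 0 (g x + max_birkhoff g m (T x))
  else cst 0.

Lemma max_birkhoff_ge0 g n x : 0 <= max_birkhoff g n x.
Proof. by case: n => //= n; rewrite le_max lexx. Qed.

Lemma max_birkhoff_leS g n x : max_birkhoff g n x <= max_birkhoff g n.+1 x.
Proof.
elim: n x => [|n IH] x; first by rewrite /= le_max lexx.
rewrite [leLHS]/= [leRHS]/=; rewrite ge_max !le_max lexx/=.
by rewrite lerD2l IH orbT.
Qed.

Lemma max_birkhoff_le g m n x :
  (m <= n)%N -> max_birkhoff g m x <= max_birkhoff g n x.
Proof.
move=> /subnK <-; elim: (n - m)%N => [|k IH] //.
exact: le_trans IH (max_birkhoff_leS _ _ _).
Qed.

Lemma birkhoff_sum_le_max g n x : birkhoff_sum g n x <= max_birkhoff g n x.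
Proof.
elim: n x => [|n IH] x; first by rewrite /birkhoff_sum big_ord0.
by rewrite birkhoff_sumS /= le_max lerD2l IH orbT.
Qed.

Lemma integrable_max_birkhoff g n : Q.-integrable setT (EFin \o g) ->
  Q.-integrable setT (EFin \o max_birkhoff g n).
Proof.
move=> gi; elim: n => [|n IH].
  exact: finite_measure_integrable_cst.
have : Q.-integrable setT
    ((EFin \o g) \+ ((EFin \o max_birkhoff g n) \o T))%E.
  by apply: integrableD => //; exact: integrable_comp_invariant.
(* By its recursion, M_{n+1} is the positive part of g + M_n o T. *)
move=> /(integrable_funepos measurableT).
apply: eq_integrable => // x _.
by rewrite funeposE /= -EFinD maxC -EFin_max.
Qed.

(* The functions max(-M_n(Tx), g x) = M_{n+1}(x) - M_n(Tx), where M_n is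
   [max_birkhoff g n], have nonnegative integral, are dominated by |g|, and
   reach g x as soon as M_n(Tx) >= - g x. *)
Lemma integral_ge0_unbounded_birkhoff_sum g : Q.-integrable setT (EFin \o g) ->
  {ae Q, forall x, forall C : R, exists n, C < birkhoff_sum g n x} ->
  (0 <= \int[Q]_x (g x)%:E)%E.
Proof.
move=> gi gub.
pose M := max_birkhoff g.
pose G n x := M n.+1 x - M n (T x).
have GE n x : G n x = Num.max (- M n (T x)) (g x).
  rewrite /G /M /=; case: (leP 0) => h; case: (leP (- _)) => //; lra.
have Mi n : Q.-integrable setT (EFin \o M n) by exact: integrable_max_birkhoff.
have MTi n : Q.-integrable setT (fun x => (M n (T x))%:E).
  by have := integrable_comp_invariant (Mi n).
have Gi n : Q.-integrable setT (EFin \o G n).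
  have -> : EFin \o G n = ((EFin \o M n.+1) \- (fun x => (M n (T x))%:E))%E.
    by apply/funext => x.
  exact: integrableB.
have G0 n : (0 <= \int[Q]_x (G n x)%:E)%E.
  rewrite /G; under eq_integral do rewrite EFinB.
  rewrite integralB_EFin//; last exact: MTi.
  have /= -> := integral_comp_invariant (Mi n).
  rewrite sube_ge0.
    apply: (le_integral measurableT (Mi n) (Mi n.+1)) => x _.
    by rewrite lee_fin; exact: max_birkhoff_leS.
  by rewrite (integrable_fin_num measurableT (Mi n)).
have [|||||_ _ Gcvg] := @dominated_convergence _ _ R Q setT measurableT
    (fun n => EFin \o G n) (EFin \o g) (abse \o (EFin \o g)).
- by move=> n; exact: (measurable_int _ (Gi n)).
- exact: (measurable_int _ gi).
(* The bound C = 0 suffices: a positive sum is nonempty, and dropping its first term leaves a sum at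
   [T x] larger than - g x. *)
- apply: filterS gub => x /(_ 0) gub _.
  have [n gn] : exists n, - g x < M n (T x).
    case: gub => -[|n]; first by rewrite /birkhoff_sum big_ord0 ltxx.
    rewrite birkhoff_sumS => gn; exists n.
    have := birkhoff_sum_le_max g n (T x); rewrite -/(M n (T x)); lra.
  apply: cvg_near_cst; exists n => // m /= nm.
  rewrite /= GE; congr EFin; apply/max_idPr.
  have := max_birkhoff_le g (T x) nm; rewrite -/(M _) -/(M _); lra.
- exact: integrable_abse.
- apply: aeW => x n _; rewrite /= lee_fin GE.
  have := max_birkhoff_ge0 g n (T x); rewrite -/(M n (T x)) => M0.
  have [g0|g0] := leP 0 (g x).
    by rewrite (max_idPr _) ?ger0_norm//; lra.
  rewrite ler0_norm; last by rewrite ge_max; lra.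
  by rewrite ltr0_norm// lerN2 le_max lexx orbT.
rewrite -[leRHS](cvg_lim _ Gcvg)//; apply: lime_ge.
  by apply/cvg_ex; eexists; exact: Gcvg.
exact: nearW.
Qed.

End MaximalErgodic.

(** * An invariant probability in the core, by Cesaro averaging *)

Section InvariantProbability.
Context {d : measure_display} {Omega : measurableType d} {R : realType}.

Lemma invn_lt_near (e : R) : 0 < e -> \forall n \near \oo, n%:R^-1 < e.
Proof.
move=> e0; exists (Num.truncn e^-1).+1 => // n /= ne.
have en : e^-1 < n%:R.
  by apply: lt_le_trans (truncnS_gt _) _; rewrite ler_nat.
have n0 : 0 < n%:R :> R by apply: lt_trans en; rewrite invr_gt0.
by rewrite invf_plt ?posrE.
Qed.

(** Iterating the preimage, rather than taking the preimage under [iter k T], lets measurability and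
    the invariance of [V] pass to every k by direct induction. *)
Definition avg_preimage (P : probability Omega R) (T : Omega -> Omega)
    (A : set Omega) (n : nat) : R :=
  n%:R^-1 * \sum_(k < n) fine (P (iter k (preimage T) A)).

Lemma avg_preimage_le (P : probability Omega R) (T : Omega -> Omega) A n c :
  0 <= c -> (forall k, fine (P (iter k (preimage T) A)) <= c) ->
  avg_preimage P T A n <= c.
Proof.
move=> c0 Pc; rewrite /avg_preimage.
(* At n = 0 the average is 0, which is where 0 <= c enters. *)
case: n => [|n]; first by rewrite big_ord0 mulr0.
rewrite mulrC ler_pdivrMr ?ltr0n// mulr_natr.
rewrite -[n.+1 in leRHS]card_ord -sumr_const.
by apply: ler_sum => i _.
Qed.

(* Any limit point of the Cesaro averages of the P \o T^-k is dominated by V,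
   and the continuity of V at the empty set makes it countably additive. *)
Lemma invariant_probability_in_core (P : probability Omega R)
    (T : Omega -> Omega) (V : set Omega -> R) : measurable_fun setT T ->
  upper_probability V -> T_invariant_cap T V -> in_core V P ->
  exists2 Q : probability Omega R,
    forall A, measurable A -> Q (T @^-1` A) = Q A & in_core V Q.
Proof.
move=> mT uV VT PV.
have mpreT A : measurable A -> measurable (T @^-1` A).
  by move=> mA; rewrite -[X in measurable X]setTI; exact: mT.
have mpre k A : measurable A -> measurable (iter k (preimage T) A).
  by move=> mA; elim: k => //= k; exact: mpreT.
have Vpre k A : measurable A -> V (iter k (preimage T) A) = V A.
  by move=> mA; elim: k => //= k <-; apply: VT; exact: mpre.
(* One ultrafilter finer than the filter at infinity yields limits for all measurable sets
   simultaneously, and these limits are additive in the set. *)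
have [U [UU ooU]] := ultraFilterLemma (@eventually_filter).
pose a := avg_preimage P T.
have a_ge0 A n : 0 <= a A n.
  by rewrite mulr_ge0 ?invr_ge0// sumr_ge0// => i _; rewrite fine_ge0.
have a_le1 A n : measurable A -> a A n <= 1.
  move=> mA; apply: avg_preimage_le => // k.
  rewrite -[leRHS]/(fine 1%E) -(@probability_setT _ _ _ P).
  by apply: fine_probability_le => //; exact: mpre.
have aV A n : measurable A -> a A n <= V A.
  move=> mA; apply: avg_preimage_le; first exact: upper_probability_ge0.
  by move=> k; rewrite -(Vpre k)//; apply: PV; exact: mpre.
have /choice[l lP] A : exists l : R, measurable A -> a A @ U --> l.
  have [mA|nmA] := pselect (measurable A); last by exists 0.
  have [|l al] := @ultrafilter_cvg_bounded _ U (a A) 0 1 UU; last by exists l.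
  by move=> n; rewrite a_ge0 a_le1.
have UP : ProperFilter U := @ultra_proper _ U UU.
have luniq A (x : R) : measurable A -> a A @ U --> x -> x = l A.
  by move=> mA ax; exact: norm_cvg_unique ax (lP _ mA).
have l_ge0 A : measurable A -> 0 <= l A.
  by move=> mA; apply: cvgr_to_ge (lP _ mA) _; exact: nearW.
have lV A : measurable A -> l A <= V A.
  by move=> mA; apply: cvgr_to_le (lP _ mA) _; apply: nearW => n; exact: aV.
have lT : l setT = 1.
  apply/esym/luniq => //; apply: cvg_near_cst; apply: ooU.
  exists 1%N => // n /= n0; rewrite /a /avg_preimage.
  under eq_bigr => k _.
    rewrite (_ : iter k _ _ = setT); last by elim: (k : nat) => //= ? ->.
    rewrite probability_setT /=; over.
  by rewrite sumr_const card_ord mulVf// pnatr_eq0 -lt0n.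
have lU A B : measurable A -> measurable B -> A `&` B = set0 ->
    l (A `|` B) = l A + l B.
  move=> mA mB AB0; apply/esym/luniq; first exact: measurableU.
  have -> : a (A `|` B) = a A \+ a B.
    apply/funext => n; rewrite /a /avg_preimage /= -mulrDr -big_split/=.
    congr *%R; apply: eq_bigr => k _.
    have -> : iter k (preimage T) (A `|` B) =
        iter k (preimage T) A `|` iter k (preimage T) B.
      by elim: (k : nat) => //= j ->.
    rewrite measureU; [|exact: mpre..|].
      by rewrite fineD//; apply: fin_num_measure; exact: mpre.
    elim: (k : nat) => //= j IH.
    by rewrite -preimage_setI IH preimage_set0.
  by apply: cvgD; exact: lP.
have linv A : measurable A -> l (T @^-1` A) = l A.
  move=> mA; apply/esym/luniq; first exact: mpreT.
  have -> : a (T @^-1` A) = a A \+ (a (T @^-1` A) \- a A).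
    by apply/funext => n /=; ring.
  rewrite -[X in _ --> X]addr0; apply: cvgD; first exact: lP.
  (* The difference of the averages telescopes to (P (T^-n A) - P A) / n, of absolute value at most
     1/n. *)
  apply: cvg_trans (_ : (a (T @^-1` A) \- a A) @ \oo --> 0).
    by move=> B; exact: ooU.
  apply/cvgrPdist_lt => e e0; near=> n.
  rewrite sub0r normrN /a /avg_preimage /= -mulrBr normrM ger0_norm ?invr_ge0//.
  apply: le_lt_trans (_ : n%:R^-1 * 1 < e); last first.
    by rewrite mulr1; near: n; exact: invn_lt_near.
  rewrite ler_wpM2l ?invr_ge0// -sumrB.
  under eq_bigr do rewrite -iterSr.
  rewrite -(big_mkord xpredT (fun k => fine (P (iter k.+1 (preimage T) A)) -
    fine (P (iter k (preimage T) A)))) telescope_sumr//=.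
  have Pb k : 0 <= fine (P (iter k (preimage T) A)) <= 1.
    rewrite fine_ge0//= -[leRHS]/(fine 1%E) -(@probability_setT _ _ _ P).
    by apply: fine_probability_le => //; exact: mpre.
  by have := Pb n; have := Pb 0%N; rewrite /= ler_norml; lra.
have [|Q QE] := finitely_additive_continuous_probability l_ge0 lT lU.
  move=> F mF Fni F0.
  have VF := upper_probability_cvg0 uV mF Fni F0.
  apply: (@squeeze_cvgr _ _ _ _ (cst 0) (V \o F)) => //.
    by apply: nearW => n; rewrite /= l_ge0// lV.
  exact: cvg_cst.
exists Q => A mA; last by rewrite QE//= lV.
by rewrite !QE ?linv//; exact: mpreT.
Unshelve. all: by end_near. Qed.
End InvariantProbability.

(** * Bounded Birkhoff sums and convergence of the averages *)

Section BoundedSums.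
Context {d : measure_display} {Omega : measurableType d} {R : realType}.
Variables (T : Omega -> Omega).
Hypothesis mT : measurable_fun setT T.

Definition bounded_birkhoff_sum (g : Omega -> R) : set Omega :=
  [set x | exists C, forall n, birkhoff_sum T g n x <= C].

Lemma measurable_iter k : measurable_fun setT (iter k T).
Proof.
elim: k => [|k IH]; first exact: measurable_id.
by have := measurableT_comp mT IH.
Qed.

Lemma measurable_birkhoff_sum (g : Omega -> R) n :
  measurable_fun setT g -> measurable_fun setT (birkhoff_sum T g n).
Proof.
move=> mg; apply: measurable_sum => i.
exact: measurableT_comp mg (measurable_iter i).
Qed.

(* Boundedness, unlike a bound on the limsup of the averages, is invariant
   under T on the nose. *)
Lemma bounded_birkhoff_sum_invariant (g : Omega -> R) : measurable_fun setT g ->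
  invariant_set T (bounded_birkhoff_sum g).
Proof.
move=> mg; split.
  (* Restricting the bounds to natural numbers makes the union countable. *)
  have -> : bounded_birkhoff_sum g =
      \bigcup_(k : nat)
        \bigcap_n (birkhoff_sum T g n @^-1` [set` `]-oo, k%:R]]).
    apply/seteqP; split => x.
      move=> [C xC]; exists (Num.truncn C).+1 => // n _ /=.
      by rewrite in_itv/= (le_trans (xC n))// ltW// truncnS_gt.
    by move=> [k _ xk]; exists k%:R => n; have := xk n I; rewrite /= in_itv.
  apply: bigcupT_measurable => k; apply: bigcapT_measurable => n.
  by rewrite -[X in measurable X]setTI; exact: measurable_birkhoff_sum.
apply/seteqP; split => x /= [C xC].
  (* The 0 in the maximum accounts for the empty sum at n = 0. *)
  exists (Num.max 0 (g x + C)) => -[|n].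
    by rewrite /birkhoff_sum big_ord0 le_max lexx.
  by rewrite birkhoff_sumS le_max lerD2l xC orbT.
by exists (C - g x) => n; have := xC n.+1; rewrite birkhoff_sumS; lra.
Qed.

(** A bound C on the sums of f - m - 1/(k+1) says that the n-th average of f is at most m + 1/(k+1)
    + C/n; the other family gives the matching lower bound. *)
Lemma cvg_birkhoff_avg (f : Omega -> R) (x : Omega) (m : R) :
  (forall k, bounded_birkhoff_sum (fun y => f y - m - k.+1%:R^-1) x) ->
  (forall k, bounded_birkhoff_sum (fun y => m - f y - k.+1%:R^-1) x) ->
  birkhoff_avg T f x @ \oo --> m.
Proof.
move=> ub lb; apply/cvgrPdist_lt => e e0.
have [k _ /(_ k (leqnn k)) ke] :=
  near_infty_natSinv_lt (PosNum (divr_gt0 e0 (ltr0n R 2))).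
have [C1 hC1] := ub k; have [C2 hC2] := lb k.
(* The 1 keeps [C] positive, so that n can be chosen with C/n < e/2; the other half of [e] absorbs
   1/(k+1). *)
pose C := Num.max 1 (Num.max C1 C2).
have C0 : 0 < C by rewrite /C lt_max ltr01.
have [N' _ N'P] := invn_lt_near (divr_gt0 (divr_gt0 e0 (ltr0n R 2)) C0).
exists N'.+1 => // n /= N'n.
have n0 : 0 < n%:R :> R by rewrite ltr0n (leq_ltn_trans _ N'n).
have := N'P n (ltnW N'n).
rewrite /= ltr_pdivlMr// ltr_pdivrMl// => Cn.
have sumB (c c' : R) :
    birkhoff_sum T (fun y => c * f y + c') n x =
    c * birkhoff_sum T f n x + n%:R * c'.
  rewrite /birkhoff_sum big_split/= sumr_const card_ord mulr_natl.
  by rewrite mulr_sumr.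
have := hC1 n; have := hC2 n.
have -> : (fun y => f y - m - k.+1%:R^-1) =
    (fun y => 1 * f y + (- m - k.+1%:R^-1)).
  by apply/funext => y; ring.
have -> : (fun y => m - f y - k.+1%:R^-1) =
    (fun y => -1 * f y + (m - k.+1%:R^-1)).
  by apply/funext => y; ring.
rewrite !sumB// => h2 h1.
have c1 : C1 <= C by rewrite !le_max lexx orbT.
have c2 : C2 <= C by rewrite !le_max lexx !orbT.
rewrite /birkhoff_avg -/(birkhoff_sum T f n x).
have ke2 : n%:R * k.+1%:R^-1 < n%:R * (e / 2) by rewrite ltr_pM2l.
rewrite -[X in X - _](mulKf (lt0r_neq0 n0)) -mulrBr normrM.
rewrite gtr0_norm ?invr_gt0//.
rewrite ltr_pdivrMl// ltr_norml.
move: Cn ke2 h1 h2; set z := k.+1%:R^-1; set S := birkhoff_sum _ _ _ _.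
by set w := n%:R => *; apply/andP; split; lra.
Qed.

End BoundedSums.

(** * Transfer of null sets through the ergodic capacity *)

Section ErgodicCapacity.
Context {d : measure_display} {Omega : measurableType d} {R : realType}.
Variables (T : Omega -> Omega) (V : set Omega -> R).
Hypothesis mT : measurable_fun setT T.
Hypothesis eV : ergodic_cap T V.
Variable Q : probability Omega R.
Hypothesis QT : forall A, measurable A -> Q (T @^-1` A) = Q A.
Hypothesis QV : in_core V Q.

Lemma in_core_null (P : probability Omega R) A :
  in_core V P -> measurable A -> V A = 0 -> P A = 0%E.
Proof.
move=> PV mA VA0; have := PV _ mA; rewrite VA0 => PA.
rewrite -(@fineK _ (P A)) ?fin_num_measure//; congr EFin.
by apply/eqP; rewrite eq_le PA fine_ge0.
Qed.

(** For an invariant set, ergodicity of [V] makes it or its complement [V]-null, and domination by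
    [V] makes that one [Q]-null. *)
Lemma in_core_ergodic_prob : ergodic_prob T Q.
Proof.
split=> // B iB; have mB := iB.1.
have [_ [VB|VB]] := eV.2 _ iB; first by left; exact: in_core_null.
right; rewrite -[B]setCK probability_setC; last exact: measurableC.
by rewrite (in_core_null QV) ?sube0//; exact: measurableC.
Qed.

Lemma ae_bounded_birkhoff_sum (P : probability Omega R) (g : Omega -> R) :
  in_core V P -> measurable_fun setT g -> Q.-integrable setT (EFin \o g) ->
  (\int[Q]_x (g x)%:E < 0)%E -> {ae P, forall x, bounded_birkhoff_sum T g x}.
Proof.
move=> PV mg gi g0.
have iB := bounded_birkhoff_sum_invariant mT mg; have mB := iB.1.
have [_ [VB|VB]] := eV.2 _ iB; last first.
  exists (~` bounded_birkhoff_sum T g); split => //.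
    exact: measurableC.
  by apply: in_core_null => //; exact: measurableC.
(* Here the boundedness set is [V]-null, hence [Q]-null: the sums are unbounded above [Q]-a.e.,
   which forces a nonnegative integral. *)
move: g0; rewrite ltNge => /negP; case.
apply: (integral_ge0_unbounded_birkhoff_sum mT QT gi).
exists (bounded_birkhoff_sum T g); split => //.
  exact: in_core_null.
move=> x; apply: contra_notP => nB C; apply: contrapT => nC.
apply: nB; exists C => n; rewrite leNgt; apply/negP => Cn.
by apply: nC; exists n.
Qed.

Lemma birkhoff_in_core (P : probability Omega R) (f : Omega -> R) :
  in_core V P -> measurable_fun setT f -> Q.-integrable setT (EFin \o f) ->
  {ae P, forall x, birkhoff_avg T f x @ \oo --> fine (\int[Q]_x (f x)%:E)}.
Proof.
move=> PV mf fi; set m := fine _.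
have mE : (\int[Q]_x (f x)%:E = m%:E)%E.
  by rewrite fineK//; exact: (integrable_fin_num measurableT fi).
have cint (c : R) : (\int[Q]_x c%:E = c%:E)%E.
  rewrite integral_cst// -[RHS]mule1; congr *%E.
  exact: probability_setT.
have ci (c : R) : Q.-integrable setT (EFin \o cst c).
  exact: finite_measure_integrable_cst.
have ub k : {ae P, forall x,
    bounded_birkhoff_sum T (fun y => f y - m - k.+1%:R^-1) x}.
  (* With this constant, f - c has [Q]-integral -1/(k+1) < 0. *)
  pose c : R := m + k.+1%:R^-1.
  have -> : (fun y => f y - m - k.+1%:R^-1) = (fun y => f y - c).
    by apply/funext => y; rewrite /c; ring.
  apply: ae_bounded_birkhoff_sum => //.
  - exact: measurable_realfun.measurable_funB.
  - exact: (integrableB measurableT fi (ci c)).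
  - under eq_integral do rewrite EFinB.
    rewrite (integralB_EFin measurableT fi (ci c)) mE cint -EFinB lte_fin.
    by rewrite /c opprD addNKr oppr_lt0 invr_gt0.
have lb k : {ae P, forall x,
    bounded_birkhoff_sum T (fun y => m - f y - k.+1%:R^-1) x}.
  pose c : R := m - k.+1%:R^-1.
  have -> : (fun y => m - f y - k.+1%:R^-1) = (fun y => c - f y).
    by apply/funext => y; rewrite /c; ring.
  apply: ae_bounded_birkhoff_sum => //.
  - exact: measurable_realfun.measurable_funB.
  - exact: (integrableB measurableT (ci c) fi).
  - under eq_integral do rewrite EFinB.
    rewrite (integralB_EFin measurableT (ci c) fi) mE cint -EFinB lte_fin.
    by rewrite /c addrAC subrr sub0r oppr_lt0 invr_gt0.
(* The [P]-null exceptional sets, two for each k, are countably many. *)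
apply: filterS2 (ae_foralln ub) (ae_foralln lb) => x ubx lbx.
exact: cvg_birkhoff_avg.
Qed.

End ErgodicCapacity.

(** * Existence and uniqueness of the ergodic probability *)

Theorem corollary3p4 (d : measure_display) (Omega : measurableType d)
  (R : realType) (P : probability Omega R) (T : Omega -> Omega)
  (mT : measurable_fun setT T) (V : set Omega -> R) :
  upper_probability V -> ergodic_cap T V -> in_core V P ->
  exists Q : probability Omega R,
    [/\ ergodic_prob T Q, in_core V Q,
      (forall f : Omega -> R, measurable_fun setT f ->
         Q.-integrable setT (EFin \o f) ->
         {ae P, forall w, birkhoff_avg T f w @ \oo -->
                            fine (\int[Q]_x (f x)%:E)})
    & (forall Q' : probability Omega R,
         ergodic_prob T Q' -> in_core V Q' ->
         (forall f : Omega -> R, measurable_fun setT f ->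
            Q'.-integrable setT (EFin \o f) ->
            {ae P, forall w, birkhoff_avg T f w @ \oo -->
                               fine (\int[Q']_x (f x)%:E)}) ->
         forall A, measurable A -> Q' A = Q A)].
Proof.
move=> uV eV PV.
have [Q QT QV] := invariant_probability_in_core mT uV eV.1 PV.
have bQ := birkhoff_in_core mT eV QT QV PV.
exists Q; split => //; first exact (in_core_ergodic_prob eV QT QV).
move=> Q' _ _ bQ' A mA.
have mI : measurable_fun setT (\1_A : Omega -> R).
  exact: measurable_realfun.measurable_indic.
have QA := bQ _ mI (integrable_indic Q mA).
have Q'A := bQ' _ mI (integrable_indic Q' mA).
have := filterI QA Q'A => -[Z [mZ PZ0 ZE]].
(* [Z] is [P]-null, so some point lies outside it; there the averages of the indicator of [A] tend
   to both [Q A] and [Q' A]. *)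
have [w nZw] : ~` Z !=set0.
  apply/set0P/negP => /eqP Z0.
  have := probability_setC P mZ; rewrite Z0 measure0 PZ0 sube0.
  by move=> /esym/eqP; rewrite onee_eq0.
have [wQ wQ'] : [set x | birkhoff_avg T \1_A x @ \oo -->
    fine (\int[Q]_x (\1_A x)%:E)] w /\ [set x | birkhoff_avg T \1_A x @ \oo -->
    fine (\int[Q']_x (\1_A x)%:E)] w.
  by apply: contrapT => nw; apply: nZw; exact: ZE.
have := norm_cvg_unique wQ' wQ.
rewrite !integral_indic// !setIT => QQ'.
by rewrite -[LHS]fineK ?fin_num_measure// QQ' fineK ?fin_num_measure.
Qed.
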